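(* Let $n,d$ be integers with $n>2$ and $d\ge 2$. Then $$I_{(n,d,0),2}^{\,n-1}=\mathbf m^{(n-1)d}.$$
   Context: $K$ is a field, $S=K[x_1,\dots,x_n]$ and $\mathbf m=(x_1,\dots,x_n)$. $I_{(n,d,0),2}\subset S$ is the ideal generated by all monomials $u$ of degree $d$ with $|\operatorname{supp}(u)|\le 2$, where $\operatorname{supp}(u)=\{i : x_i\mid u\}$. *)

(* Defs.v *)
From HB Require Import structures.
From mathcomp Require Import all_boot all_order all_algebra.
From mathcomp Require Import mpoly.

Set Implicit Arguments.
Unset Strict Implicit.
Unset Printing Implicit Defensive.

Import GRing.Theory.
Local Open Scope ring_scope.

(* Ideals are Prop-valued subsets: [idealr] in ring_quotient.v only covers
   decidable proper ideals, with no generation, product or power. *)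
Section Ideals.

Variable R : comNzRingType.

Definition ideal_gen (A : R -> Prop) (f : R) : Prop :=
  exists (k : nat) (c g : 'I_k -> R),
    (forall i, A (g i)) /\ f = \sum_(i < k) c i * g i.

Definition ideal_mul (I J : R -> Prop) : R -> Prop :=
  ideal_gen (fun h => exists f g : R, [/\ I f, J g & h = f * g]).

Fixpoint ideal_exp (I : R -> Prop) (k : nat) : R -> Prop :=
  if k is k'.+1 then ideal_mul I (ideal_exp I k') else fun _ => True.

Definition ideal_eq (I J : R -> Prop) : Prop := forall f : R, I f <-> J f.

End Ideals.

(* [<=] on multinomials is pointwise, i.e. divisibility of monomials. *)
Definition msupport (n : nat) (u : 'X_{1..n}) : {set 'I_n} :=
  [set i | (U_(i) <= u)%MM].

Definition max_ideal (n : nat) (K : fieldType) : {mpoly K[n]} -> Prop :=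
  ideal_gen (fun p => exists i : 'I_n, p = 'X_i).

(* The ideal I_{(n,d,0),2} of K[x_1, ..., x_n]. *)
Definition supp2_ideal (n d : nat) (K : fieldType) : {mpoly K[n]} -> Prop :=
  ideal_gen (fun p => exists u : 'X_{1..n},
    [/\ mdeg u = d, (#|msupport u| <= 2)%N & p = 'X_[u]]).

(* Main.v *)
Require Import Defs.
From HB Require Import structures.
From mathcomp Require Import all_boot all_order all_algebra.
From mathcomp Require Import mpoly.
From mathcomp Require Import zify.

(** The k-th power of an ideal generated by a set [A] is generated by the
    products of [k] elements of [A] ([ideal_exp_gen]).  Both sides are thus
    monomial ideals, and it suffices to see that they have the same generators:
    the monomials of degree [(n - 1) * d].  For the maximal ideal this is clear.
    For the other ideal, the point is that a monomial [w] of degree [k * d]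
    involving at most [k + 1] variables is a product of [k] monomials of degree
    [d], each in at most two variables ([supp2_factorization]); the bound on the
    support is automatic when [k + 1 = n].

    The factorization is by induction on [k]: one splits off a factor of degree
    [d] so that the cofactor has at most [k] variables ([supp2_factor_step]).  If
    [w] already has at most [k] variables, some exponent is at least the average
    [k * d / k = d], and a pure power of that variable will do.  If [w] has
    exactly [k + 1] variables, some exponent [w i] is below [d] since the average
    is; and some other exponent [w j] satisfies [w i + w j >= d], as otherwise the
    degree would be too small.  The factor [x_i ^ w_i * x_j ^ (d - w_i)] then
    uses up the variable [x_i] completely. *)

Set Implicit Arguments.
Unset Strict Implicit.
Unset Printing Implicit Defensive.

Import GRing.Theory.
Local Open Scope ring_scope.

(** * Powers of ideals given by generators *)

Section GeneratedIdeals.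

Variable R : comNzRingType.
Implicit Types (A B : R -> Prop) (P : R -> Prop) (f g h c : R).

Lemma ideal_gen0 A : ideal_gen A 0.
Proof. by exists 0%N, (fun=> 0), (fun=> 0); split=> [[]|]; rewrite ?big_ord0. Qed.

Lemma ideal_gen_cons A c g f :
  A g -> ideal_gen A f -> ideal_gen A (c * g + f).
Proof.
move=> Ag [k [cs [gs [Ags ->]]]].
exists k.+1, (fun i => oapp cs c (unlift ord0 i)).
exists (fun i => oapp gs g (unlift ord0 i)); split=> [i|].
  by case: (unlift ord0 i).
rewrite big_ord_recl !unlift_none /=; congr (_ + _).
by apply: eq_bigr => i _; rewrite !liftK.
Qed.

(** Together with [ideal_gen0] and [ideal_gen_cons], this presents a generated
    ideal inductively, so that no indexed sum is manipulated afterwards. *)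
Lemma ideal_gen_elim A P :
    P 0 -> (forall c g f, A g -> P f -> P (c * g + f)) ->
  forall f, ideal_gen A f -> P f.
Proof.
move=> P0 Pcons f [k [c [g [Ag ->]]]].
elim: k c g Ag => [|k IHk] c g Ag; first by rewrite big_ord0.
by rewrite big_ord_recl; apply: Pcons => //; apply: IHk.
Qed.

Lemma ideal_gen_add A f g :
  ideal_gen A f -> ideal_gen A g -> ideal_gen A (f + g).
Proof.
move=> + Ig; elim/ideal_gen_elim: f / => [|c a f Aa If]; first by rewrite add0r.
by rewrite -addrA; apply: ideal_gen_cons.
Qed.

Lemma ideal_gen_mull A c f : ideal_gen A f -> ideal_gen A (c * f).
Proof.
elim/ideal_gen_elim: f / => [|b a f Aa If]; first by rewrite mulr0; apply: ideal_gen0.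
by rewrite mulrDr mulrA; apply: ideal_gen_cons.
Qed.

Lemma ideal_gen_mem A g : A g -> ideal_gen A g.
Proof.
by move=> Ag; rewrite -[g]mul1r -[_ * _]addr0; apply: ideal_gen_cons (ideal_gen0 A).
Qed.

Lemma ideal_gen_sub A B :
    (forall g, A g -> ideal_gen B g) ->
  forall f, ideal_gen A f -> ideal_gen B f.
Proof.
move=> AB; apply: ideal_gen_elim => [|c g f /AB Bg Bf]; first exact: ideal_gen0.
by apply: ideal_gen_add Bf; apply: ideal_gen_mull.
Qed.

Lemma eq_ideal_gen A B :
  (forall g, A g <-> B g) -> ideal_eq (ideal_gen A) (ideal_gen B).
Proof.
by move=> AB f; split; apply: ideal_gen_sub => g /AB; apply: ideal_gen_mem.
Qed.

Definition gen_mul A B h := exists f g, [/\ A f, B g & h = f * g].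

Fixpoint gen_exp A k : R -> Prop :=
  if k is k'.+1 then gen_mul A (gen_exp A k') else fun h => h = 1.

Lemma ideal_gen_mul A B f g :
  ideal_gen A f -> ideal_gen B g -> ideal_gen (gen_mul A B) (f * g).
Proof.
move=> + Bg; elim/ideal_gen_elim: f / => [|c a f Aa IHf].
  by rewrite mul0r; apply: ideal_gen0.
rewrite mulrDl; apply: ideal_gen_add IHf; rewrite -mulrA; apply: ideal_gen_mull.
elim/ideal_gen_elim: g / Bg => [|b b' g Bb IHg].
  by rewrite mulr0; apply: ideal_gen0.
by rewrite mulrDr mulrCA; apply: ideal_gen_cons IHg; exists a, b'.
Qed.

(** Distributing a product of linear combinations gives one inclusion; the other
    holds because a product of generators is in particular a product of elements
    of the ideal. *)
Lemma ideal_exp_gen A k :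
  ideal_eq (ideal_exp (ideal_gen A) k) (ideal_gen (gen_exp A k)).
Proof.
elim: k => [|k IHk] f /=.
  by split=> // _; rewrite -[f]mulr1; apply/ideal_gen_mull/ideal_gen_mem.
split; apply: ideal_gen_sub => _ [g [h [Ag Ah ->]]].
  by apply: ideal_gen_mul => //; apply/IHk.
apply: ideal_gen_mem; exists g, h; split=> //; first exact: ideal_gen_mem.
by apply/IHk/ideal_gen_mem.
Qed.

End GeneratedIdeals.

(** * Factoring a monomial into monomials in at most two variables *)

Section Monomials.

Variable n : nat.
Implicit Types (u v w : 'X_{1..n}) (i j : 'I_n).

Lemma in_msupport u i : (i \in msupport u) = (0 < u i)%N.
Proof. by rewrite inE lep1mP lt0n. Qed.

Lemma mdeg_msupport w : mdeg w = (\sum_(i in msupport w) w i)%N.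
Proof.
rewrite mdegE [RHS]big_mkcond /=; apply: eq_bigr => i _.
by rewrite in_msupport; case: (w i).
Qed.

Lemma msupport_sub u w : msupport (w - u)%MM \subset msupport w.
Proof.
by apply/subsetP=> i; rewrite !in_msupport mnmBE; lia.
Qed.

Lemma card_msupport_le2 u i j :
  (forall k, k != i -> k != j -> u k = 0%N) -> (#|msupport u| <= 2)%N.
Proof.
move=> u0; suff /subset_leq_card sub: msupport u \subset [set i; j].
  by apply: leq_trans sub _; rewrite cards2; case: (i != j).
apply/subsetP=> k; rewrite in_msupport !inE.
by apply: contraTT; rewrite negb_or => /andP[/u0 ki /ki ->].
Qed.

(** With as many variables as [k + 2], the factor has to exhaust one of them, so
    it is built from a variable of exponent below [d] and completed by another
    one; with fewer variables there is nothing to lose and a pure power will do,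
    but a large enough exponent must exist. *)
Lemma supp2_factor_step d k w :
    (0 < d)%N -> mdeg w = (k.+1 * d)%N -> (#|msupport w| <= k.+2)%N ->
  exists u, [/\ mdeg u = d, (#|msupport u| <= 2)%N, (u <= w)%MM
              & (#|msupport (w - u)%MM| <= k.+1)%N].
Proof.
move=> d0 degw; rewrite leq_eqVlt => /orP[/eqP cardw|]; last first.
  rewrite ltnS => cardw.
  have [i di]: exists i, (d <= w i)%N.
    apply/existsP; apply: contraTT (leqnn (mdeg w)) => /existsPn small.
    rewrite {1}degw -ltnNge mdeg_msupport.
    have: (\sum_(i in msupport w) w i <= \sum_(i in msupport w) d.-1)%N.
      by apply: leq_sum => i _; have := small i; lia.
    move/leq_ltn_trans; apply; rewrite sum_nat_const.
    by apply: leq_ltn_trans (leq_mul cardw (leqnn _)) _; rewrite ltn_pmul2l; lia.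
  have le_uw : (U_(i) *+ d <= w)%MM.
    by apply/mnm_lepP=> j; rewrite mulmnE mnm1E; case: eqP => [<-|_]; lia.
  exists (U_(i) *+ d)%MM; split=> //.
  - by rewrite mdegMn mdeg1 mul1n.
  - apply: (@card_msupport_le2 _ i i) => j ji _.
    by rewrite mulmnE mnm1E eq_sym (negPf ji).
  - exact: leq_trans (subset_leq_card (msupport_sub _ _)) cardw.
have [i [iw di]]: exists i, i \in msupport w /\ (w i < d)%N.
  have [/existsP[i /andP[]]|/existsPn big] :=
    boolP [exists i, (i \in msupport w) && (w i < d)%N]; first by exists i.
  have: (\sum_(i in msupport w) d <= \sum_(i in msupport w) w i)%N.
    by apply: leq_sum => i iw; have := big i; rewrite iw /= -leqNgt.
  by rewrite sum_nat_const cardw -mdeg_msupport degw; nia.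
have cardwi : #|msupport w :\ i| = k.+1.
  by move: cardw; rewrite (cardsD1 i) iw add1n => -[].
have [j [ji dj]]: exists j, j != i /\ (d <= w i + w j)%N.
  have [/existsP[j /andP[]]|/existsPn small] :=
    boolP [exists j, (j != i) && (d <= w i + w j)%N]; first by exists j.
  (* The k + 1 remaining variables all have exponent below d - w i. *)
  have: (\sum_(j in msupport w :\ i) w j
         <= \sum_(j in msupport w :\ i) (d.-1 - w i))%N.
    apply: leq_sum => j; rewrite !inE => /andP[ji _].
    by have := small j; rewrite ji /=; lia.
  rewrite sum_nat_const cardwi.
  move: degw; rewrite mdeg_msupport (big_setD1 i iw) /= => degw lesum.
  (* Writing d as a sum turns the truncated d.-1 - w i into an atom, which makes
     the contradiction linear. *)
  have dE : d = (d.-1 - w i + w i + 1)%N by lia.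
  have wi_le : (w i <= k.+1 * w i)%N by apply: leq_pmull.
  move: degw lesum; rewrite {1}dE !mulnDr => degw.
  by rewrite -(leq_add2l (w i)) degw => ?; lia.
have uE l : (U_(i) *+ w i + U_(j) *+ (d - w i))%MM l =
    ((i == l) * w i + (j == l) * (d - w i))%N.
  by rewrite mnmDE !mulmnE !mnm1E.
have le_uw : (U_(i) *+ w i + U_(j) *+ (d - w i) <= w)%MM.
  apply/mnm_lepP=> l; rewrite uE.
  case: eqP => [<-|_]; first by rewrite (negPf ji); lia.
  by case: eqP => [<-|_]; lia.
exists (U_(i) *+ w i + U_(j) *+ (d - w i))%MM; split=> //.
- by rewrite mdegD !mdegMn !mdeg1; lia.
- apply: (@card_msupport_le2 _ i j) => l li lj.
  by rewrite uE eq_sym (negPf li) eq_sym (negPf lj).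
- suff /subset_leq_card: msupport (w - (U_(i) *+ w i + U_(j) *+ (d - w i)))%MM
      \subset msupport w :\ i by rewrite cardwi.
  apply/subsetP=> l lw; rewrite in_setD1 (subsetP (msupport_sub _ _) _ lw) andbT.
  apply: contraTneq lw => ->; rewrite in_msupport mnmBE uE eqxx (negPf ji).
  by rewrite mul1n addn0 subnn.
Qed.

Variable R : comNzRingType.

Definition monomials (M : 'X_{1..n} -> Prop) (p : {mpoly R[n]}) : Prop :=
  exists2 w, M w & p = 'X_[w].

Lemma gen_exp_mdeg (A : {mpoly R[n]} -> Prop) d :
    (forall p, A p -> monomials (fun w => mdeg w = d) p) ->
  forall k p, gen_exp A k p -> monomials (fun w => mdeg w = (k * d)%N) p.
Proof.
move=> degA; elim=> [|k IHk] p /=.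
  by move=> ->; exists 0%MM; rewrite ?mdeg0 ?mpolyX0.
move=> [f [g [/degA[u du ->] /IHk[v dv ->] ->]]].
by exists (u + v)%MM; rewrite ?mpolyXD // mdegD du dv mulSn.
Qed.

(** The support bound is what makes the induction work: one variable more than
    there are factors is always allowed. *)
Lemma supp2_factorization d k w :
    (0 < d)%N -> mdeg w = (k * d)%N -> (#|msupport w| <= k.+1)%N ->
  gen_exp (monomials (fun u => mdeg u = d /\ (#|msupport u| <= 2)%N)) k 'X_[w].
Proof.
move=> d0; elim: k w => [|k IHk] w degw suppw /=.
  by move/eqP: degw; rewrite mdeg_eq0 => /eqP ->; rewrite mpolyX0.
have [u [du su uw sv]] := supp2_factor_step d0 degw suppw.
exists 'X_[u], 'X_[w - u]; split; first by exists u.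
  apply: IHk => //; apply: (@addIn (mdeg u)).
  by rewrite -mdegD submK // degw du mulSn addnC.
by rewrite -mpolyXD addmC submK.
Qed.

Lemma variable_factorization k w :
  mdeg w = k -> gen_exp (fun p : {mpoly R[n]} => exists i, p = 'X_i) k 'X_[w].
Proof.
elim: k w => [|k IHk] w degw /=.
  by move/eqP: degw; rewrite mdeg_eq0 => /eqP ->; rewrite mpolyX0.
have [i wi]: exists i, (0 < w i)%N.
  apply/existsP; apply: contra_eqT degw => /existsPn w0.
  by rewrite mdegE big1 // => i _; have := w0 i; lia.
have iw : (U_(i) <= w)%MM by rewrite lep1mP -lt0n.
exists 'X_i, 'X_[w - U_(i)]; split; first by exists i.
  apply: IHk; apply: (@addIn (mdeg U_(i)%MM)).
  by rewrite -mdegD submK // degw mdeg1 addn1.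
by rewrite -mpolyXD addmC submK.
Qed.

End Monomials.

(** * The two powers *)

Lemma max_ideal_exp (K : fieldType) n k :
  ideal_eq (ideal_exp (@max_ideal n K) k)
           (ideal_gen (@monomials n K (fun w => mdeg w = k))).
Proof.
move=> f; apply: iff_trans (ideal_exp_gen _ _ _) _; apply: eq_ideal_gen => p.
split=> [|[w degw ->]]; last exact: variable_factorization.
rewrite -{2}[k]muln1; apply: gen_exp_mdeg => _ [i ->].
by exists U_(i)%MM; rewrite ?mdeg1.
Qed.

Lemma supp2_ideal_exp (K : fieldType) n d k :
    (0 < d)%N -> (n <= k.+1)%N ->
  ideal_eq (ideal_exp (@supp2_ideal n d K) k)
           (ideal_gen (@monomials n K (fun w => mdeg w = (k * d)%N))).
Proof.
move=> d0 nk f; apply: iff_trans (ideal_exp_gen _ _ _) _.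
apply: eq_ideal_gen => p; split=> [|[w degw ->]].
  by apply: gen_exp_mdeg => _ [u [du _ ->]]; exists u.
have suppw : (#|msupport w| <= k.+1)%N.
  by apply: leq_trans (max_card _) _; rewrite card_ord.
have := supp2_factorization K d0 degw suppw.
elim: k 'X_[w] {degw suppw nk} => //= k IHk q [g [h [[u [du su] ->] /IHk kh ->]]].
by exists 'X_[u], h; split=> //; exists u.
Qed.

Theorem proposition5p5 (K : fieldType) (n d : nat) (hn : (2 < n)%N) (hd : (2 <= d)%N) :
  ideal_eq (ideal_exp (@supp2_ideal n d K) (n - 1)) (ideal_exp (@max_ideal n K) ((n - 1) * d)).
Proof.
move=> f; apply: iff_trans _ (iff_sym (max_ideal_exp _ f)).
by apply: supp2_ideal_exp; lia.
Qed.
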